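(* Consider the $n$-dimensional cylindrical Veselova top, with $n>4$ and mass tensor $\mathbb{J}=\mathrm{diag}[J_1,\dots,J_1,J_2,\dots,J_2]$. Consider any solution to the reduced equations on $\mathcal{R}=T^*\mathrm{S}^{n-1}/G_R$, and a choice of initial lift to both $T^*\mathrm{S}^{n-1}$ and $D$. Then there exist choices of (orthonormal) basis of $\mathbb{R}^n$ in the body and in space such that with respect to these bases the lifted solutions have the form $$q(t)=\begin{pmatrix}\bar q(t)\\0\end{pmatrix},\quad p(t)=\begin{pmatrix}\bar p(t)\\0\end{pmatrix},\quad g(t)=\begin{pmatrix}\bar g(t)&0\\0&\mathrm{Id}_{n-4}\end{pmatrix},\quad \Omega(t)=\begin{pmatrix}\bar\Omega(t)&0\\0&0_{n-4}\end{pmatrix},$$ where $(\bar q(t),\bar p(t))\in T^*\mathrm{S}^3$ and $(\bar g(t),\bar\Omega(t))\in D(4)\subset T\mathrm{O}(4)$ satisfy the equations of motion of the cylindrical 4D Veselova top (for $(\bar g,\bar\Omega)$) and its reduced equations (for $(\bar q,\bar p)$), with mass tensor $\bar{\mathbb{J}}=\mathrm{diag}[J_1,J_1,J_2,J_2]$.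
   Context: The $m$-dimensional Veselova top with mass tensor $\mathbb{J}=\mathrm{diag}[j_1,\dots,j_m]$, $j_i>0$: put $a\wedge b=ab^T-ba^T$, $\langle\Lambda,\Omega\rangle=\tfrac12\mathrm{tr}(\Lambda^T\Omega)$ and $\mathbb{I}(\Omega)=\mathbb{J}\Omega+\Omega\mathbb{J}$ on $\mathfrak{so}(m)$; let $e_1,\dots,e_m$ be an orthonormal basis of space ($e_1$ the distinguished axis) and $f_1,\dots,f_m$ a principal basis of the body, each identified with the standard basis of $\mathbb{R}^m$. For $g\in\mathrm{O}(m)$ put $q=g^{-1}e_1$, $E_r=g^{-1}e_r$. Phase space (with $T\mathrm{O}(m)\cong\mathrm{O}(m)\times\mathfrak{so}(m)$, $\Omega=g^{-1}\dot g$): $D=D(m)=\{(g,\Omega):\Omega=q\wedge v\text{ for some }v\in\mathbb{R}^m\}$. Equations of motion: $\dot g=g\Omega$, $\frac{d}{dt}\mathbb{I}(\Omega)=[\mathbb{I}(\Omega),\Omega]+\sum_{2\le r<s\le m}\lambda_{rs}E_r\wedge E_s$, with $\lambda_{rs}$ uniquely determined by preservation of the constraints $\langle E_r\wedge E_s,\Omega\rangle=0$. Reduced equations on $T^*\mathrm{S}^{m-1}=\{(q,p)\in\mathbb{R}^m\times\mathbb{R}^m:\|q\|=1,\ q\cdot p=0\}$, reached via $(g,\Omega)\mapsto(q,p)$, $q=g^{-1}e_1$, $p=-\mathbb{I}(\Omega)q$: $$\dot q=C\left[p-\frac{p\cdot Cq}{q\cdot Cq}q\right],\quad \dot p=-2Hq,\quad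 C=(\mathbb{J}+(q\cdot\mathbb{J}q)\mathrm{Id}_m)^{-1},\quad H=\tfrac12\left(p\cdot Cp-\tfrac{(p\cdot Cq)^2}{q\cdot Cq}\right).$$ Cylindrical top: $m=n$, $\mathbb{J}=\mathrm{diag}[J_1,\dots,J_1,J_2,\dots,J_2]$, $J_1\ne J_2$ with multiplicities $r,r'$, $2\le r\le r'$, $r+r'=n$; $G_R=\mathrm{O}(r)\times\mathrm{O}(r')$ acts diagonally on $T^*\mathrm{S}^{n-1}$, preserving the equations, and the dynamics descends to $\mathcal{R}$. An initial lift is a choice of $(g_0,\Omega_0)\in D$ with image $(q_0,p_0)\in T^*\mathrm{S}^{n-1}$ projecting to the initial point in $\mathcal{R}$. Changing the orthonormal bases in body and space by orthogonal matrices $P_b$ and $P_s$ replaces $q,p,g,\Omega$ by $P_bq,\ P_bp,\ P_s\,g\,P_b^T,\ P_b\Omega P_b^T$ (and $\mathbb{J}$ by $P_b\mathbb{J}P_b^T$). *)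

(* Defs.v *)
From HB Require Import structures.
From mathcomp Require Import all_boot all_order all_algebra.
From mathcomp Require Import all_classical all_reals all_analysis.

Set Implicit Arguments.
Unset Strict Implicit.
Unset Printing Implicit Defensive.

Import Order.TTheory GRing.Theory Num.Theory.
Import numFieldNormedType.Exports.

Local Open Scope classical_set_scope.
Local Open Scope ring_scope.

Section Veselova.
Context {R : realType}.

Definition dotv m (u v : 'cV[R]_m) : R := (u^T *m v) 0 0.

(* 0-based: [evec m 0] is the distinguished axis e_1. *)
Definition evec m (k : nat) : 'cV[R]_m := \col_(i < m) ((i : nat) == k)%:R.

(* For m = n this is membership in O(n). The rectangular type lets us change
   basis from R^n to R^m when m and n are equal but not convertible, such as
   r + r' and 4 + (r + r' - 4); the two equations force m = n. *)
Definition is_orthomx m n (P : 'M[R]_(m, n)) : Prop :=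
  P^T *m P = 1%:M /\ P *m P^T = 1%:M.

Definition vwedge m (a b : 'cV[R]_m) : 'M[R]_m := a *m b^T - b *m a^T.

Definition inertia m (J Om : 'M[R]_m) : 'M[R]_m := J *m Om + Om *m J.

Definition lie_bracket m (A B : 'M[R]_m) : 'M[R]_m := A *m B - B *m A.

(* The space vector e_{k+1} seen in the body frame; [body_axis g 0] is q. *)
Definition body_axis m (g : 'M[R]_m) (k : nat) : 'cV[R]_m :=
  invmx g *m evec m k.

Definition Dspace m (g Om : 'M[R]_m) : Prop :=
  is_orthomx g /\ exists v : 'cV[R]_m, Om = vwedge (body_axis g 0) v.

(* The multipliers are existentially quantified; since (g, Om) stays in D they
   are the ones determined by preservation of the constraints. The summation
   range 1 <= k < l < m is 2 <= r < s <= m in 1-based notation. *)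
Definition top_solution m (J : 'M[R]_m) (T : set R) (g Om : R -> 'M[R]_m) :
    Prop :=
  forall t, T t ->
  [/\ Dspace (g t) (Om t),
      is_derive t 1 g (g t *m Om t) &
      exists lambda : nat -> nat -> R,
        is_derive t 1 (fun s => inertia J (Om s))
          (lie_bracket (inertia J (Om t)) (Om t)
           + \sum_(1 <= k < m) \sum_(k.+1 <= l < m)
               lambda k l *: vwedge (body_axis (g t) k) (body_axis (g t) l))].

Definition reduction m (J g Om : 'M[R]_m) : 'cV[R]_m * 'cV[R]_m :=
  (body_axis g 0, - (inertia J Om *m body_axis g 0)).

Definition cotangent_sphere m (q p : 'cV[R]_m) : Prop :=
  dotv q q = 1 /\ dotv q p = 0.

Definition Cmx m (J : 'M[R]_m) (q : 'cV[R]_m) : 'M[R]_m :=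
  invmx (J + (dotv q (J *m q))%:M).

Definition hamiltonian m (J : 'M[R]_m) (q p : 'cV[R]_m) : R :=
  let C := Cmx J q in
  2^-1 * (dotv p (C *m p) - dotv p (C *m q) ^+ 2 / dotv q (C *m q)).

Definition reduced_solution m (J : 'M[R]_m) (T : set R)
    (q p : R -> 'cV[R]_m) : Prop :=
  forall t, T t ->
  let C := Cmx J (q t) in
  [/\ cotangent_sphere (q t) (p t),
      is_derive t 1 q
        (C *m (p t - (dotv (p t) (C *m q t) / dotv (q t) (C *m q t)) *: q t)) &
      is_derive t 1 p (- (2 * hamiltonian J (q t) (p t)) *: q t)].

Definition cyl_mass (r r' : nat) (J1 J2 : R) : 'M[R]_(r + r') :=
  diag_mx (row_mx (const_mx J1) (const_mx J2)).

(* Points of T^*S^(n-1) / G_R, G_R = O(r) x O(r'), are represented by the orbits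
   themselves, as subsets of R^n x R^n. *)
Definition GR_orbit r r' (x : 'cV[R]_(r + r') * 'cV[R]_(r + r')) :
    set ('cV[R]_(r + r') * 'cV[R]_(r + r')) :=
  [set y | exists (A : 'M[R]_r) (B : 'M[R]_r'),
     [/\ is_orthomx A, is_orthomx B &
         y = (block_mx A 0 0 B *m x.1, block_mx A 0 0 B *m x.2)]].

(* G_R does not act freely, so the quotient need not be a manifold; the dynamics
   on it is the one induced by projecting solutions on T^*S^(n-1). *)
Definition quotient_solution r r' (J1 J2 : R) (T : set R)
    (c : R -> set ('cV[R]_(r + r') * 'cV[R]_(r + r'))) : Prop :=
  exists q p : R -> 'cV[R]_(r + r'),
    reduced_solution (cyl_mass r r' J1 J2) T q p /\
    forall t, T t -> c t = GR_orbit (q t, p t).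

(* (q, p) lifts c to T^*S^(n-1) and (g, Om) lifts (q, p) to D. *)
Definition lifted_solution r r' (J1 J2 : R) (T : set R)
    (c : R -> set ('cV[R]_(r + r') * 'cV[R]_(r + r')))
    (q p : R -> 'cV[R]_(r + r')) (g Om : R -> 'M[R]_(r + r')) : Prop :=
  let J := cyl_mass r r' J1 J2 in
  [/\ reduced_solution J T q p,
      forall t, T t -> GR_orbit (q t, p t) = c t,
      top_solution J T g Om &
      forall t, T t -> reduction J (g t) (Om t) = (q t, p t)].

End Veselova.

(* Main.v *)
Require Import Defs.
From HB Require Import structures.
From mathcomp Require Import all_boot all_order all_algebra.
From mathcomp Require Import all_classical all_reals all_analysis.
From mathcomp Require Import ring lra zify.

Set Implicit Arguments.
Unset Strict Implicit.
Unset Printing Implicit Defensive.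

Import Order.TTheory GRing.Theory Num.Theory.
Import numFieldNormedType.Exports.

Local Open Scope classical_set_scope.
Local Open Scope ring_scope.

(** Why the theorem holds.  Split q0 and p0 along the two eigenspaces R^r and
R^r' of the mass tensor.  Each eigenspace contributes two vectors, so there is
a J-invariant subspace W of dimension 4 = 2 + 2 that contains q0 and p0; the
body basis Pb is adapted to R^n = W + W^perp and to the eigenspaces.  Write A
for the first four rows of Pb and B for the others; then A J = Jb A and
B J = D B, where Jb and D are the diagonal blocks of Pb J Pb^T.

The reduced flow preserves W.  As C is a function of J, it commutes with the
splitting, and Bq, Bp satisfy a homogeneous linear system whose coefficients
are continuous along the solution; they vanish at time 0, hence forever
([linear_ode_zero], [reduced_solution_invariant]).

The angular velocity lives in so(W).  If Om is the wedge of q and v, then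
applying B to p = - I(Om) q and using Bq = Bp = 0 gives
(D + (q . Jq) Id) B v = 0; the matrix is positive, so Bv = 0 and B Om = 0
([angular_velocity_invariant]).  Hence (g B^T)' = g Om B^T = 0: the attitude of
the body directions in W^perp is constant.  The space basis Ps is chosen so that
these constant vectors are its last n - 4 vectors and its first vector is still
e_1 ([adapted_space_basis]).  Orthogonality then makes Ps g Pb^T block diagonal
with identity lower block.

The upper-left blocks solve the 4-dimensional equations
([block_reduction]).  The equations transform well under A and A^T because A
intertwines J and Jb and A^T A is the identity on W.  The one delicate
term is the reaction torque, since Ps moves the axes e_2, ..., e_n: the
combinations of the E_r /\ E_s with r, s >= 2 are exactly the skew matrices
that kill q ([reactionP]), a description in which no basis appears and which
is inherited by the upper-left block. *)

(** * Orthogonal matrices and alignment of vectors *)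

Section Dot.
Context {R : realType}.

Lemma dotvE m (u v : 'cV[R]_m) : dotv u v = \sum_i u i 0 * v i 0.
Proof. by rewrite /dotv mxE; apply: eq_bigr => i _; rewrite mxE. Qed.

Lemma trmx_mul_dotv m (u v : 'cV[R]_m) : u^T *m v = (dotv u v)%:M.
Proof. by rewrite [LHS]mx11_scalar. Qed.

Lemma dotvC m (u v : 'cV[R]_m) : dotv u v = dotv v u.
Proof. by rewrite !dotvE; apply: eq_bigr => i _; rewrite mulrC. Qed.

Lemma dotvDl m (u v w : 'cV[R]_m) : dotv (u + v) w = dotv u w + dotv v w.
Proof. by rewrite /dotv linearD mulmxDl mxE. Qed.

Lemma dotvZl m (a : R) (u v : 'cV[R]_m) : dotv (a *: u) v = a * dotv u v.
Proof. by rewrite /dotv linearZ -scalemxAl mxE. Qed.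

Lemma dotvBl m (u v w : 'cV[R]_m) : dotv (u - v) w = dotv u w - dotv v w.
Proof. by rewrite dotvDl -scaleN1r dotvZl mulN1r. Qed.

Lemma dotvDr m (u v w : 'cV[R]_m) : dotv u (v + w) = dotv u v + dotv u w.
Proof. by rewrite dotvC dotvDl !(dotvC u). Qed.

Lemma dotvZr m (a : R) (u v : 'cV[R]_m) : dotv u (a *: v) = a * dotv u v.
Proof. by rewrite dotvC dotvZl (dotvC u). Qed.

Lemma dotvBr m (u v w : 'cV[R]_m) : dotv u (v - w) = dotv u v - dotv u w.
Proof. by rewrite dotvC dotvBl !(dotvC u). Qed.

Lemma dotv_mulmx m n (P : 'M[R]_(m, n)) u v :
  dotv (P *m u) v = dotv u (P^T *m v).
Proof. by rewrite /dotv trmx_mul mulmxA. Qed.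

Lemma dotv_ge0 m (u : 'cV[R]_m) : 0 <= dotv u u.
Proof. by rewrite dotvE sumr_ge0// => i _; rewrite -expr2 sqr_ge0. Qed.

Lemma dotv_eq0 m (u : 'cV[R]_m) : dotv u u = 0 -> u = 0.
Proof.
rewrite dotvE => /eqP; rewrite psumr_eq0; last first.
  by move=> i _; rewrite -expr2 sqr_ge0.
move=> /allP u0; apply/colP => i; have := u0 i; rewrite mem_index_enum mxE.
by move=> /(_ isT); rewrite mulf_eq0 orbb => /eqP.
Qed.

Lemma dotv_evec m (u : 'cV[R]_m) (i : 'I_m) : dotv u (evec m i) = u i 0.
Proof.
rewrite dotvE (bigD1 i)//= mxE eqxx mulr1 big1 ?addr0// => j ji.
by rewrite mxE (inj_eq val_inj) (negbTE ji) mulr0.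
Qed.

Lemma orthomx_mul m n k (P : 'M[R]_(m, n)) (Q : 'M[R]_(n, k)) :
  is_orthomx P -> is_orthomx Q -> is_orthomx (P *m Q).
Proof.
move=> [PTP PPT] [QTQ QQT]; split; rewrite trmx_mul mulmxA.
  by rewrite -(mulmxA _ _ P) PTP mulmx1.
by rewrite -(mulmxA _ Q) QQT mulmx1.
Qed.

Lemma orthomx_tr m n (P : 'M[R]_(m, n)) : is_orthomx P -> is_orthomx P^T.
Proof. by case=> PTP PPT; split; rewrite trmxK. Qed.

(** The Householder reflection in the hyperplane orthogonal to u - w, which
exchanges two vectors of equal length. The last clause is what allows a second
reflection to be composed without disturbing an axis already in place. *)
Lemma reflection_exists m (u w : 'cV[R]_m) : dotv u u = dotv w w ->
  exists H : 'M[R]_m, [/\ is_orthomx H, H *m u = w &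
    forall z, dotv (u - w) z = 0 -> H *m z = z].
Proof.
move=> uw; have [->|duw] := eqVneq u w.
  by exists 1%:M; split => [|| z _]; rewrite ?mul1mx//; split; rewrite trmx1 mul1mx.
set d := u - w; have dd : dotv d d != 0.
  by apply: contra_neq duw => /dotv_eq0 /eqP; rewrite subr_eq0 => /eqP.
pose H := 1%:M - (2 / dotv d d) *: (d *m d^T).
have Hz z : H *m z = z - (2 / dotv d d * dotv d z) *: d.
  by rewrite mulmxBl mul1mx -scalemxAl -mulmxA trmx_mul_dotv mul_mx_scalar scalerA.
have HT : H^T = H by rewrite /H linearB linearZ /= trmx1 trmx_mul trmxK.
have HH : H *m H = 1%:M.
  have Hd : H *m d = - d.
    by rewrite Hz divfK// scaler_nat mulr2n opprD addrA subrr sub0r.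
  rewrite {2}/H mulmxBr mulmx1 -scalemxAr mulmxA Hd mulNmx scalerN opprK.
  by rewrite /H subrK.
have dd2 : dotv d d = 2 * dotv d u.
  by rewrite {1 3}/d !dotvBl {2}/d !dotvBr -uw (dotvC w u); ring.
exists H; split; first by split; rewrite HT.
  2: by move=> z dz; rewrite Hz dz mulr0 scale0r subr0.
rewrite Hz; suff -> : 2 / dotv d d * dotv d u = 1 by rewrite scale1r /d subKr.
by rewrite mulrAC -dd2 divff.
Qed.

(** Two orthogonal changes of basis, the second fixing the first axis, bring any
pair of vectors into the span of the first two axes: a QR decomposition. *)
Lemma orthomx_align2 m (u v : 'cV[R]_m) : (2 <= m)%N ->
  exists2 O : 'M[R]_m, is_orthomx O &
    forall i : 'I_m, (2 <= i)%N -> (O *m u) i 0 = 0 /\ (O *m v) i 0 = 0.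
Proof.
move=> m2; pose i0 : 'I_m := Ordinal (ltnW m2); pose i1 : 'I_m := Ordinal m2.
have e00 : dotv (evec m i0) (evec m i0) = 1 :> R by rewrite dotv_evec mxE.
have e11 : dotv (evec m i1) (evec m i1) = 1 :> R by rewrite dotv_evec mxE.
have e01 : dotv (evec m i0) (evec m i1) = 0 :> R by rewrite dotv_evec mxE.
have e10 : dotv (evec m i1) (evec m i0) = 0 :> R by rewrite dotv_evec mxE.
have [|O1 [ O1o O1u _]] :=
    @reflection_exists _ u (Num.sqrt (dotv u u) *: evec m i0).
  by rewrite dotvZl dotvZr e00 mulr1 -expr2 sqr_sqrtr// dotv_ge0.
set v' := O1 *m v.
pose s := dotv v' v' - v' i0 0 ^+ 2.
have s0 : 0 <= s.
  rewrite /s dotvE (bigD1 i0)//= -expr2 addrC addrK sumr_ge0// => i _.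
  by rewrite -expr2 sqr_ge0.
(* The target keeps the component of v' on the first axis: the difference is
   orthogonal to that axis, which the reflection therefore fixes. *)
have [|O2 [ O2o O2v O2f]] :=
    @reflection_exists _ v' (v' i0 0 *: evec m i0 + Num.sqrt s *: evec m i1).
  rewrite !(dotvDl, dotvDr, dotvZl, dotvZr) e00 e11 e01 e10 !mulr0 !mulr1.
  by rewrite addr0 add0r -!expr2 sqr_sqrtr// /s addrC subrK.
exists (O2 *m O1); first exact: orthomx_mul.
move=> i i2; have ne0 : (i == 0 :> nat) = false by case: (nat_of_ord i) i2.
have ne1 : (i == 1 :> nat) = false by case: (nat_of_ord i) i2 => [|[]].
rewrite -!mulmxA O1u -/v' O2v -scalemxAr O2f.
  by rewrite !mxE ne0 ne1 !mulr0 addr0.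
by rewrite dotvBl dotvDl !dotvZl e00 e10 dotv_evec; ring.
Qed.
End Dot.

(** * A body basis adapted to the initial data *)

Section Basis.
Context {R : realType}.

(** Enumerates R^r + R^r' with the leading pair of each summand first: positions
0, 1 are the axes 0, 1 of R^r, positions 2, 3 the axes 0, 1 of R^r', and the
remaining axes of R^r and then of R^r' follow. *)
Definition adapted_index (r i : nat) : nat :=
  if (i < 2)%N then i else if (i < 4)%N then (i - 2 + r)%N
  else if (i < r + 2)%N then (i - 2)%N else i.

Lemma adapted_index_lt r r' (i : 'I_(4 + (r + r' - 4))) :
  (2 <= r)%N -> (2 <= r')%N -> (adapted_index r i < r + r')%N.
Proof.
move=> r2 r'2; have := ltn_ord i; rewrite /adapted_index.
by repeat case: ifP => ?; lia.
Qed.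

Lemma adapted_index_inj r : (2 <= r)%N -> injective (adapted_index r).
Proof.
move=> r2 i j; rewrite /adapted_index.
by repeat case: ifP => ?; lia.
Qed.

(** The sizes are related by an equation because 4 + (n - 4) and n are equal but
not convertible. *)
Lemma rowsub1_orthomx m n (f : 'I_m -> 'I_n) : m = n -> injective f ->
  is_orthomx (rowsub f 1%:M : 'M[R]_(m, n)).
Proof.
move=> mn; case: n / mn f => f finj.
have PPT : rowsub f 1%:M *m (rowsub f 1%:M)^T = 1%:M :> 'M[R]_m.
  rewrite mul_rowsub_mx mul1mx; apply/matrixP => i j.
  by rewrite !mxE (inj_eq finj) eq_sym.
by split => //; apply: mulmx1C.
Qed.

Lemma rowsub_diag_mx m n (f : 'I_m -> 'I_n) (w : 'rV[R]_n) : injective f ->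
  rowsub f 1%:M *m diag_mx w *m (rowsub f 1%:M)^T = diag_mx (\row_i w 0 (f i)).
Proof.
move=> finj; rewrite mul_rowsub_mx mul1mx.
apply/matrixP => i j; rewrite !mxE (bigD1 (f j))//= !mxE eqxx mulr1 big1.
  by rewrite addr0 (inj_eq finj); case: eqP => // ->.
by move=> k kj; rewrite !mxE (eq_sym (f j)) (negbTE kj) mulr0.
Qed.

Lemma orthomx_block m n (A : 'M[R]_m) (B : 'M[R]_n) :
  is_orthomx A -> is_orthomx B -> is_orthomx (block_mx A 0 0 B).
Proof.
move=> [A1 A2] [B1 B2].
by split; rewrite tr_block_mx mulmx_block !trmx0 !mulmx0 !mul0mx !addr0 !add0r
  ?A1 ?A2 ?B1 ?B2 -scalar_mx_block.
Qed.

(** G_R is a symmetry group of the mass tensor, which is scalar on each summand. *)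
Lemma block_mx_cyl_mass r r' (J1 J2 : R) (A : 'M[R]_r) (B : 'M[R]_r') :
  is_orthomx A -> is_orthomx B ->
  block_mx A 0 0 B *m cyl_mass r r' J1 J2 *m (block_mx A 0 0 B)^T
  = cyl_mass r r' J1 J2.
Proof.
move=> [_ A2] [_ B2].
have dE k (a : R) : diag_mx (const_mx a) = a%:M :> 'M[R]_k.
  by apply/matrixP => i j; rewrite !mxE.
rewrite /cyl_mass diag_mx_row !dE tr_block_mx !mulmx_block !trmx0.
rewrite !mulmx0 !mul0mx !addr0 !add0r !mul_mx_scalar -!scalemxAl A2 B2.
by rewrite !mul0mx !scalemx1.
Qed.

Lemma cyl_weight_gt0 r r' (J1 J2 : R) (i : 'I_(r + r')) : 0 < J1 -> 0 < J2 ->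
  0 < row_mx (const_mx J1 : 'rV_r) (const_mx J2 : 'rV_r') 0 i.
Proof.
by move=> ? ?; rewrite mxE; case: fintype.split => j; rewrite mxE.
Qed.

(** Align q and p within each eigenspace of the mass tensor by an element of G_R,
then permute the axes so that the two leading axes of each eigenspace come
first. The first four rows span W, and q and p lie in W. *)
Lemma adapted_body_basis r r' (J1 J2 : R) (q p : 'cV[R]_(r + r')) :
  (2 <= r)%N -> (2 <= r')%N -> 0 < J1 -> 0 < J2 ->
  exists (P : 'M[R]_(4 + (r + r' - 4), r + r')) (d : 'rV[R]_(r + r' - 4)),
    [/\ is_orthomx P, forall j, 0 < d 0 j,
        P *m cyl_mass r r' J1 J2 *m P^T
        = block_mx (cyl_mass 2 2 J1 J2 : 'M[R]_4) 0 0 (diag_mx d),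
        dsubmx (P *m q) = 0 & dsubmx (P *m p) = 0].
Proof.
move=> r2 r'2 J10 J20.
have [A Ao Az] := orthomx_align2 (usubmx q) (usubmx p) r2.
have [B Bo Bz] := orthomx_align2 (dsubmx q) (dsubmx p) r'2.
pose f (i : 'I_(4 + (r + r' - 4))) := Ordinal (adapted_index_lt i r2 r'2).
have finj : injective f.
  by move=> i j /(congr1 val) /= /(adapted_index_inj r2) /val_inj.
pose w : 'rV[R]_(r + r') := row_mx (const_mx J1) (const_mx J2).
have wE i : w 0 i = if (i < r)%N then J1 else J2.
  rewrite /w -(fintype.splitK i); case: (fintype.split i) => j /=.
    by rewrite row_mxEl mxE ltn_ord.
  by rewrite row_mxEr mxE ltnNge leq_addr.
have Pz (u : 'cV[R]_(r + r')) :
    (forall i : 'I_r, (2 <= i)%N -> (A *m usubmx u) i 0 = 0) ->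
    (forall i : 'I_r', (2 <= i)%N -> (B *m dsubmx u) i 0 = 0) ->
    dsubmx (rowsub f 1%:M *m block_mx A 0 0 B *m u) = 0.
  move=> Au Bu; apply/colP => j; rewrite -mulmxA mul_rowsub_mx mul1mx.
  rewrite -[u in LHS]vsubmxK mul_block_col !mul0mx addr0 add0r.
  rewrite [LHS]mxE [LHS]mxE [RHS]mxE.
  (* From position 4 on, adapted_index avoids the two leading axes of each
     summand, and the other coordinates were made to vanish. *)
  have jlt := ltn_ord j.
  have : nat_of_ord (f (rshift 4 j)) = adapted_index r (4 + j) by [].
  rewrite /adapted_index -[f _]fintype.splitK; case: (fintype.split _) => k /= kE.
    rewrite col_mxEu Au//; have := ltn_ord k.
    by move: kE; repeat case: ifP => ?; lia.
  rewrite col_mxEd Bu//.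
  by move: kE; repeat case: ifP => ?; lia.
exists (rowsub f 1%:M *m block_mx A 0 0 B), (\row_j w 0 (f (rshift 4 j))); split.
- apply: orthomx_mul; last exact: orthomx_block.
  by apply: rowsub1_orthomx finj; lia.
- by move=> j; rewrite mxE wE; case: ifP.
- rewrite trmx_mul !mulmxA -(mulmxA _ _ (cyl_mass _ _ _ _)).
  rewrite -(mulmxA _ (_ *m _)) block_mx_cyl_mass// rowsub_diag_mx// -/w.
  rewrite /cyl_mass -diag_mx_row; congr diag_mx; apply/rowP => i; rewrite mxE.
  rewrite -(fintype.splitK i); case: (fintype.split i) => j /=; last first.
    by rewrite row_mxEr [RHS]mxE.
  rewrite row_mxEl wE -(@fintype.splitK 2 2 j).
  case: (@fintype.split 2 2 j) => k;
    rewrite ?(@row_mxEl _ 1 2 2, @row_mxEr _ 1 2 2) mxE /= /adapted_index /=.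
    by rewrite ltn_ord /= (leq_trans (ltn_ord k) r2).
  case: ifP => // H; exfalso; have := ltn_ord k; move: H.
  by repeat case: ifP => ?; lia.
- by apply: Pz => i i2; [have [] := Az i i2|have [] := Bz i i2].
- by apply: Pz => i i2; [have [] := Az i i2|have [] := Bz i i2].
Qed.
End Basis.

(** * Derivatives of matrix-valued curves *)

Section MatrixDerivative.
Context {R : realType}.

Lemma is_derive_mxP m n (F : R -> 'M[R]_(m, n)) (t : R) (dF : 'M[R]_(m, n)) :
  is_derive t 1 F dF <->
  forall i j, is_derive t 1 (fun s => F s i j) (dF i j).
Proof.
split=> [[dF1 dF2] i j|dF1].
  split; first exact: (derivable_mxP _ _ _).1.
  by rewrite -dF2 derive_mx// mxE.
have drv : derivable F t 1 by apply/derivable_mxP => i j; case: (dF1 i j).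
split => //; rewrite derive_mx//; apply/matrixP => i j.
by rewrite mxE; case: (dF1 i j).
Qed.

(** The form taken by a change of orthonormal bases, and by passing to a block. *)
Lemma is_derive_mulmx_cst m n k l (P : 'M[R]_(m, n)) (Q : 'M[R]_(k, l))
    (F : R -> 'M[R]_(n, k)) (t : R) (dF : 'M[R]_(n, k)) :
  is_derive t 1 F dF ->
  is_derive t 1 (fun s => P *m F s *m Q) (P *m dF *m Q).
Proof.
move=> /is_derive_mxP dF1; apply/is_derive_mxP => i j.
rewrite (_ : (fun s => _) =
  \sum_b ((fun s => Q b j * (\sum_a (fun s => P i a * F s a b)) s) : R -> R));
  last first.
  apply/funext => s; rewrite fct_sumE mxE; apply: eq_bigr => b _.
  by rewrite mulrC mxE fct_sumE.
have -> : (P *m dF *m Q) i j = \sum_b (Q b j *: \sum_a (P i a *: dF a b)).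
  by rewrite mxE; apply: eq_bigr => b _; rewrite mulrC mxE.
apply: is_derive_sum => b; exact: (is_deriveZ (Q b j)).
Qed.

Lemma is_derive_mulmxl_cst m n k (P : 'M[R]_(m, n))
    (F : R -> 'M[R]_(n, k)) (t : R) (dF : 'M[R]_(n, k)) :
  is_derive t 1 F dF -> is_derive t 1 (fun s => P *m F s) (P *m dF).
Proof.
move=> /(is_derive_mulmx_cst P 1%:M); rewrite mulmx1.
by under eq_fun do rewrite mulmx1.
Qed.

Lemma is_derive_entry_continuous m n (F : R -> 'M[R]_(m, n)) (t : R) dF i j :
  is_derive t 1 F dF -> {for t, continuous (fun s => F s i j)}.
Proof.
move=> /is_derive_mxP /(_ i j) [dFij _].
exact/differentiable_continuous/derivable1_diffP.
Qed.
End MatrixDerivative.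

(** * Reaction torques *)

Section Multipliers.
Context {R : realType}.

Lemma invmx_orthomx m (g : 'M[R]_m) : is_orthomx g -> invmx g = g^T.
Proof.
move=> [gTg _]; have [_ gu] := mulmx1_unit gTg.
by rewrite -[RHS]mulmx1 -(mulmxV gu) mulmxA gTg mul1mx.
Qed.

Lemma vwedgeE m (a b : 'cV[R]_m) i j :
  vwedge a b i j = a i 0 * b j 0 - b i 0 * a j 0.
Proof. by rewrite !mxE !big_ord1 !mxE. Qed.

Lemma vwedge_skew m (a b : 'cV[R]_m) : (vwedge a b)^T = - vwedge a b.
Proof. by rewrite /vwedge linearB /= !trmx_mul !trmxK opprB. Qed.

Lemma mulmx_vwedge m n (P : 'M[R]_(m, n)) (a b : 'cV[R]_n) :
  P *m vwedge a b *m P^T = vwedge (P *m a) (P *m b).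
Proof. by rewrite /vwedge mulmxBr mulmxBl !trmx_mul !mulmxA. Qed.

Lemma vwedge_mulmx m (a b c : 'cV[R]_m) :
  vwedge a b *m c = dotv b c *: a - dotv a c *: b.
Proof. by rewrite /vwedge mulmxBl -!mulmxA !trmx_mul_dotv !mul_mx_scalar. Qed.

(** Skewness accounts for the pairs k >= l, and Y e_1 = 0 for
those that involve the distinguished axis, index 0. *)
Lemma skew_sum_evec m (Y : 'M[R]_m) : Y^T = - Y -> Y *m evec m 0 = 0 ->
  Y = \sum_(1 <= k < m) \sum_(k.+1 <= l < m)
        dotv (evec m k) (Y *m evec m l) *: vwedge (evec m k) (evec m l).
Proof.
move=> Yskew Y0.
pose L k l := dotv (evec m k) (Y *m evec m l).
have LE (i j : 'I_m) : L i j = Y i j.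
  rewrite /L dotvC dotv_evec mxE (bigD1 j)//= mxE eqxx mulr1 big1 ?addr0// => k kj.
  by rewrite mxE (inj_eq val_inj) (negbTE kj) mulr0.
have Yanti i j : Y i j = - Y j i by rewrite -[in LHS](trmxK Y) Yskew !mxE.
have Yz (i j : 'I_m) : i = 0%N :> nat -> Y j i = 0.
  by move=> i0; rewrite -LE /L i0 Y0 dotvE big1// => k _; rewrite !mxE mulr0.
have FE (i j : 'I_m) : \sum_(1 <= k < m) \sum_(k.+1 <= l < m)
    L k l * ((i == k :> nat)%:R * (j == l :> nat)%:R)
    = if (0 < i < j)%N then Y i j else 0.
  transitivity (\sum_(1 <= k < m | k == i) \sum_(k.+1 <= l < m | l == j) L k l).
    rewrite [RHS]big_mkcond; apply: eq_bigr => k _; rewrite eq_sym.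
    case: eqP => _; last by rewrite big1// => l _; rewrite mul0r mulr0.
    rewrite [RHS]big_mkcond; apply: eq_bigr => l _; rewrite eq_sym mul1r.
    by case: eqP => _; rewrite ?mulr1 ?mulr0.
  by rewrite big_nat1_eq big_nat1_eq LE !ltn_ord !andbT; do 2 case: leqP.
apply/matrixP => i j.
transitivity ((if (0 < i < j)%N then Y i j else 0)
              - (if (0 < j < i)%N then Y j i else 0)).
  have [ij|ji|/val_inj ->] := ltngtP i j; last first.
  - by rewrite !andbF subr0; have := Yanti j j; lra.
  - by rewrite andbF andbT sub0r; case: posnP => [/Yz ->|_];
      rewrite ?oppr0// [RHS]Yanti.
  - rewrite andbF andbT subr0; case: posnP => // /Yz i0.
    by rewrite Yanti i0 oppr0.
rewrite -!FE summxE -sumrB; apply: eq_bigr => k _.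
rewrite summxE -sumrB; apply: eq_bigr => l _.
by rewrite [RHS]mxE vwedgeE !mxE -mulrBr (mulrC (j == k :> nat)%:R).
Qed.

(** The axes E_2, ..., E_m form an orthonormal basis of the orthogonal of
q = E_1, so their wedges span the skew matrices that vanish on q. This makes the
existence of multipliers independent of the space axes other than e_1. *)
Lemma reactionP m (g X : 'M[R]_m) : is_orthomx g ->
  (exists lambda : nat -> nat -> R,
     X = \sum_(1 <= k < m) \sum_(k.+1 <= l < m)
           lambda k l *: vwedge (body_axis g k) (body_axis g l)) <->
  X^T = - X /\ X *m body_axis g 0 = 0.
Proof.
move=> go; have gE k : body_axis g k = g^T *m evec m k.
  by rewrite /body_axis invmx_orthomx.
split=> [[lambda ->]|[Xskew Xq]].
  split.
    rewrite linear_sum -sumrN; apply: eq_bigr => k _.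
    rewrite linear_sum -sumrN; apply: eq_bigr => l _.
    by rewrite linearZ /= vwedge_skew scalerN.
  case: m g {X} go gE => [|m] g go gE; first by apply/colP => -[].
  have e0 k : (0 < k)%N -> dotv (body_axis g k) (body_axis g 0) = 0.
    move=> k0; rewrite !gE dotv_mulmx trmxK mulmxA go.2 mul1mx.
    rewrite -[0%N]/(nat_of_ord (@ord0 m)) dotv_evec mxE eqn_leq.
    by rewrite [(k <= _)%N]leqNgt k0 andbF.
  rewrite mulmx_suml big1_seq// => k /andP[_]; rewrite mem_index_iota => /andP[k0 _].
  rewrite mulmx_suml big1_seq// => l /andP[_]; rewrite mem_index_iota => /andP[kl _].
  rewrite -scalemxAl vwedge_mulmx !e0 ?scale0r ?subrr ?scaler0//.
  exact: leq_trans kl.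
have Yskew : (g *m X *m g^T)^T = - (g *m X *m g^T).
  by rewrite !trmx_mul trmxK Xskew mulNmx mulmxN mulmxA.
have /(skew_sum_evec Yskew) YE : g *m X *m g^T *m evec m 0 = 0.
  by rewrite -!mulmxA -gE Xq mulmx0.
exists (fun k l => dotv (evec m k) (g *m X *m g^T *m evec m l)).
transitivity (g^T *m (g *m X *m g^T) *m g).
  by rewrite !mulmxA go.1 mul1mx -mulmxA go.1 mulmx1.
rewrite [in LHS]YE mulmx_sumr mulmx_suml; apply: eq_bigr => k _.
rewrite mulmx_sumr mulmx_suml; apply: eq_bigr => l _.
by rewrite !gE -mulmx_vwedge trmxK -scalemxAr -scalemxAl.
Qed.
End Multipliers.

(** * Uniqueness for linear systems on an interval *)

(** If c bounds K on [0, b], then N(t) exp(- c t) is nonincreasing, nonnegative, and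
starts at 0. *)
Lemma gronwall_zero_forward (R : realType) (N N' K : R -> R) (b : R) :
  0 <= b ->
  (forall t, 0 <= t <= b -> is_derive t 1 N (N' t)) ->
  (forall t, 0 <= t <= b -> {for t, continuous K}) ->
  (forall t, 0 <= t <= b -> `|N' t| <= K t * N t) ->
  (forall t, 0 <= N t) -> N 0 = 0 -> N b = 0.
Proof.
move=> b0 dN cK N'le N0 Nz.
have [c cb Kc] : exists2 c, c \in `[0, b]%R & forall t, t \in `[0, b]%R -> K t <= K c.
  apply: EVT_max => //; apply: continuous_in_subspaceT => t.
  by rewrite inE /= in_itv /=; apply: cK.
pose F := N * (expR \o ( *%R (- K c))).
have dF t : 0 <= t <= b ->
    is_derive t 1 F ((N' t - K c * N t) * expR (- K c * t)).
  move=> tb; have := dN t tb => dNt.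
  have dL : is_derive t 1 ( *%R (- K c)) (- K c).
    by apply: is_derive_eq; rewrite /GRing.scale /= mulr1.
  rewrite /F; apply: is_derive_eq.
  by rewrite /GRing.scale /=; ring.
have FE t : F t = N t * expR (- K c * t) by [].
have : F b <= F 0.
  apply: (@ler0_derive1_le_cc _ F 0 b); rewrite ?in_itv /= ?lexx ?b0 //.
  - move=> t; rewrite in_itv /= => /andP[/ltW t0 /ltW tb].
    by have [] := dF t; rewrite ?t0 ?tb.
  - move=> t; rewrite in_itv /= => /andP[/ltW t0 /ltW tb].
    have tb' : 0 <= t <= b by rewrite t0 tb.
    rewrite derive1E; have [_ ->] := dF t tb'.
    rewrite mulr_le0_ge0 ?expR_ge0// subr_le0.
    apply: le_trans (ler_norm _) (le_trans (N'le t tb') _).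
    by rewrite ler_wpM2r// Kc// in_itv /= t0 tb.
  - apply: continuous_in_subspaceT => t; rewrite inE /= in_itv /= => tb.
    by apply: differentiable_continuous; apply/derivable1_diffP; have [] := dF t tb.
rewrite !FE Nz mul0r pmulr_lle0 ?expR_gt0// => Nb.
by apply/eqP; rewrite eq_le Nb N0.
Qed.

(** Negative times reduce to positive ones by reversing time. *)
Lemma gronwall_zero (R : realType) (T : set R) (N N' K : R -> R) :
  is_interval T -> T 0 ->
  (forall t, T t -> is_derive t 1 N (N' t)) ->
  (forall t, T t -> {for t, continuous K}) ->
  (forall t, T t -> `|N' t| <= K t * N t) ->
  (forall t, 0 <= N t) -> N 0 = 0 ->
  forall t, T t -> N t = 0.
Proof.
move=> Titv T0 dN cK N'le N0 Nz b Tb.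
have [b0|/ltW b0] := leP 0 b.
  have sub t : 0 <= t <= b -> T t by move=> ?; exact: (Titv 0 b).
  by apply: (@gronwall_zero_forward _ N N' K) => // t /sub; auto.
have sub t : 0 <= t <= - b -> T (- t).
  by move=> /andP[? ?]; apply: (Titv b 0) => //; rewrite oppr_le0 lerNr; apply/andP.
rewrite -[b]opprK.
apply: (@gronwall_zero_forward _ (N \o -%R) (fun t => - N' (- t)) (K \o -%R)) => //.
- by rewrite oppr_ge0.
- move=> t /sub /dN dNt; rewrite -mulrN1; exact: is_derive1_comp.
- move=> t /sub /cK cKt; apply: continuous_comp => //.
  exact: opp_continuous.
- by move=> t /sub; rewrite normrN; apply: N'le.
- by move=> t; exact: N0.
- by rewrite /= oppr0.
Qed.

(** Gronwall for the energy x^2 + y^2, whose derivative is a quadratic form in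
(x, y) with continuous coefficients. *)
Lemma linear_ode_zero (R : realType) (T : set R) (x y a b c : R -> R) :
  is_interval T -> T 0 ->
  (forall t, T t -> is_derive t 1 x (a t * x t + b t * y t)) ->
  (forall t, T t -> is_derive t 1 y (c t * x t)) ->
  (forall t, T t -> [/\ {for t, continuous a}, {for t, continuous b} &
                        {for t, continuous c}]) ->
  x 0 = 0 -> y 0 = 0 ->
  forall t, T t -> x t = 0 /\ y t = 0.
Proof.
move=> Titv T0 dx dy cabc x0 y0 t Tt.
pose N s := x s ^+ 2 + y s ^+ 2.
suff : N t = 0.
  by move/eqP; rewrite paddr_eq0 ?sqr_ge0// !sqrf_eq0 => /andP[/eqP ? /eqP ?].
apply: (@gronwall_zero _ T N
  (fun s => 2 * (x s * (a s * x s + b s * y s) + y s * (c s * x s)))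
  (fun s => 2 * `|a s| + `|b s| + `|c s|)) => //.
- move=> s Ts; have := dx s Ts; have := dy s Ts => dys dxs.
  rewrite (_ : N = x ^+ 2 + y ^+ 2); last by apply/funext.
  apply: is_derive_eq (is_deriveD (is_deriveX 2 dxs) (is_deriveX 2 dys)) _.
  by rewrite /GRing.scale /=; ring.
- move=> s /cabc[ca cb cc].
  apply: cvgD; [apply: cvgD; [apply: cvgM; [exact: cvg_cst|]|]|];
    by apply: cvg_norm; assumption.
- move=> s Ts; rewrite /N.
  have xyle : `|2 * (x s * y s)| <= x s ^+ 2 + y s ^+ 2.
    by rewrite ler_norml; apply/andP; split;
      [have := sqr_ge0 (x s + y s)|have := sqr_ge0 (x s - y s)]; nra.
  rewrite [X in `|X|](_ : _ = 2 * (a s * x s ^+ 2) + (b s + c s) * (2 * (x s * y s)));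
    last by ring.
  move: (sqr_ge0 (x s)) (sqr_ge0 (y s)) xyle.
  move: (x s ^+ 2) (y s ^+ 2) (2 * (x s * y s)) => X Y Z X0 Y0 ZXY.
  rewrite -addrA (mulrDl (2 * _)); apply: le_trans (ler_normD _ _) _; apply: lerD.
    rewrite !normrM (ger0_norm X0) ger0_norm// -mulrA.
    by rewrite ler_pM2l// ler_wpM2l// lerDl.
  by rewrite normrM; apply: ler_pM => //; exact: ler_normD.
- by move=> s; rewrite addr_ge0 ?sqr_ge0.
- by rewrite /N x0 y0 expr0n addr0.
Qed.

(** The uniqueness statement applied to each entry of F - F 0, with zero
coefficients. *)
Lemma interval_const (R : realType) m n (F : R -> 'M[R]_(m, n)) (T : set R) :
  is_interval T -> T 0 -> (forall t, T t -> is_derive t 1 F 0) ->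
  forall t, T t -> F t = F 0.
Proof.
move=> Titv T0 dF t Tt; apply/matrixP => i j; apply/eqP; rewrite -subr_eq0.
apply/eqP; pose x s := F s i j - F 0 i j; rewrite -/(x t).
suff H : forall u, T u -> x u = 0 /\ (cst 0 : R -> R) u = 0 by case: (H t Tt).
apply: (@linear_ode_zero R T x (cst 0) (cst 0) (cst 0) (cst 0)) => //.
- move=> s /dF /is_derive_mxP /(_ i j); rewrite mxE => dFij.
  rewrite (_ : x = (fun s => F s i j) - cst (F 0 i j))//.
  by apply: is_derive_eq; rewrite !mul0r addr0 subr0.
- by move=> s _; rewrite mul0r; exact: is_derive_cst.
- by move=> s _; split; exact: cvg_cst.
- by rewrite /x subrr.
Qed.

(** * The matrix C of the reduced equations *)

Section Mass.
Context {R : realType}.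

Lemma dotv_diag_mx m (w : 'rV[R]_m) (u v : 'cV[R]_m) :
  dotv u (diag_mx w *m v) = \sum_i w 0 i * (u i 0 * v i 0).
Proof.
by rewrite dotvE; apply: eq_bigr => i _; rewrite mul_diag_mx mxE mulrCA.
Qed.

Lemma dotv_diag_ge0 m (w : 'rV[R]_m) (u : 'cV[R]_m) :
  (forall i, 0 < w 0 i) -> 0 <= dotv u (diag_mx w *m u).
Proof.
move=> w0; rewrite dotv_diag_mx sumr_ge0// => i _.
by apply: mulr_ge0; [exact: ltW|rewrite -expr2 sqr_ge0].
Qed.

(** For a = q . Jq this computes the matrix C. *)
Lemma diag_shift_inv m (w : 'rV[R]_m) (a : R) :
  (forall i, 0 < w 0 i) -> 0 <= a ->
  diag_mx w + a%:M \in unitmx /\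
  invmx (diag_mx w + a%:M) = diag_mx (\row_i (w 0 i + a)^-1).
Proof.
move=> w0 a0.
have E : diag_mx w + a%:M = diag_mx (\row_i (w 0 i + a)).
  by apply/matrixP => i j; rewrite !mxE mulrnDl.
have M1 : diag_mx (\row_i (w 0 i + a)) *m diag_mx (\row_i (w 0 i + a)^-1) = 1%:M.
  rewrite mulmx_diag -diag_const_mx; congr diag_mx; apply/rowP => i.
  by rewrite !mxE mulfV// gt_eqF// ltr_wpDr.
have [U _] := mulmx1_unit M1; rewrite E; split => //.
by rewrite -[RHS](mulKmx U) M1 mulmx1.
Qed.

Lemma CmxE m (w : 'rV[R]_m) (q : 'cV[R]_m) : (forall i, 0 < w 0 i) ->
  Cmx (diag_mx w) q = diag_mx (\row_i (w 0 i + dotv q (diag_mx w *m q))^-1).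
Proof. by move=> w0; rewrite /Cmx (diag_shift_inv w0 (dotv_diag_ge0 _ w0)).2. Qed.

(** C is positive definite, so the denominator q . Cq of the reduced equations
never vanishes. *)
Lemma dotv_Cmx_gt0 m (w : 'rV[R]_m) (q : 'cV[R]_m) : (forall i, 0 < w 0 i) ->
  dotv q q = 1 -> 0 < dotv q (Cmx (diag_mx w) q *m q).
Proof.
move=> w0 q1; rewrite CmxE//.
set c : 'rV_m := (\row_i _).
have c0 i : 0 < c 0 i.
  by rewrite mxE invr_gt0 ltr_wpDr// dotv_diag_ge0.
rewrite lt_neqAle dotv_diag_ge0// andbT eq_sym.
apply: contra_eq_neq q1 => /eqP.
rewrite dotv_diag_mx psumr_eq0 => [/allP q0|i _]; last first.
  by apply: mulr_ge0; [exact: ltW|rewrite -expr2 sqr_ge0].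
rewrite dotvE big1 1?eq_sym ?oner_neq0// => i _; have := q0 i (mem_index_enum i).
by rewrite mulf_eq0 gt_eqF//= => /eqP.
Qed.

(** C is a rational function of J, so a map that intertwines J and Jb also
intertwines the two matrices C. Jb + a is invertible because
A (J + a)^-1 A^T is a right inverse. *)
Lemma mass_intertwine m n (A : 'M[R]_(m, n)) (J : 'M[R]_n) (Jb : 'M[R]_m) (a : R) :
  A *m A^T = 1%:M -> A *m J = Jb *m A -> J + a%:M \in unitmx ->
  Jb + a%:M \in unitmx /\
  A *m invmx (J + a%:M) = invmx (Jb + a%:M) *m A.
Proof.
move=> AA AJ U.
have AM : A *m (J + a%:M) = (Jb + a%:M) *m A.
  by rewrite mulmxDr mulmxDl AJ scalar_mxC.
have [Ub _] : Jb + a%:M \in unitmx /\ A *m invmx (J + a%:M) *m A^T \in unitmx.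
  by apply: mulmx1_unit; rewrite !mulmxA -AM mulmxK.
by split => //; rewrite -[LHS](mulKmx Ub) [_ *m (A *m _)]mulmxA -AM mulmxK.
Qed.

End Mass.

Section Continuity.
Context {R : realType}.

Lemma eq_continuous_at (f h : R -> R) (t : R) :
  f =1 h -> {for t, continuous h} -> {for t, continuous f}.
Proof. by move=> /funext ->. Qed.

Lemma continuous_sum_at n (f : 'I_n -> R -> R) (t : R) :
  (forall i, {for t, continuous (f i)}) ->
  {for t, continuous (fun s => \sum_i f i s)}.
Proof.
move=> fc.
have E : (fun s => \sum_i f i s) = \sum_i f i by apply/funext => s; rewrite fct_sumE.
rewrite E /prop_for /continuous_at; elim/big_ind: _ => //.
- exact: cvg_cst.
- by move=> f1 f2 ? ?; apply: cvgD.
- by move=> i _; exact: fc.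
Qed.

Lemma continuous_dotv_diag n (c u v : R -> 'I_n -> R) (t : R) :
  (forall i, {for t, continuous (c^~ i)}) ->
  (forall i, {for t, continuous (u^~ i)}) ->
  (forall i, {for t, continuous (v^~ i)}) ->
  {for t, continuous (fun s => \sum_i c s i * (u s i * v s i))}.
Proof.
move=> cc uc vc; apply: continuous_sum_at => i.
by apply: cvgM; [exact: cc|apply: cvgM; [exact: uc|exact: vc]].
Qed.
End Continuity.

(** * Invariance of W under the reduced flow *)

Section Reduction.
Context {R : realType}.

Lemma reduced_coefs_continuous n (w : 'rV[R]_n) (q p : R -> 'cV[R]_n) (t : R) :
  (forall i, 0 < w 0 i) -> dotv (q t) (q t) = 1 ->
  (forall i, {for t, continuous (fun s => q s i 0)}) ->
  (forall i, {for t, continuous (fun s => p s i 0)}) ->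
  let J := diag_mx w in
  [/\ {for t, continuous (fun s => dotv (q s) (J *m q s))},
      {for t, continuous (fun s => dotv (p s) (Cmx J (q s) *m q s)
                                    / dotv (q s) (Cmx J (q s) *m q s))} &
      {for t, continuous (fun s => hamiltonian J (q s) (p s))}].
Proof.
move=> w0 q1 qc pc J.
have sc : {for t, continuous (fun s => dotv (q s) (J *m q s))}.
  apply: eq_continuous_at => [s|]; first exact: dotv_diag_mx.
  by apply: continuous_dotv_diag => // i; exact: cvg_cst.
have Cc (u v : R -> 'cV[R]_n) :
    (forall i, {for t, continuous (fun s => u s i 0)}) ->
    (forall i, {for t, continuous (fun s => v s i 0)}) ->
    {for t, continuous (fun s => dotv (u s) (Cmx J (q s) *m v s))}.
  move=> uc vc; apply: (@eq_continuous_at R _ (fun s =>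
      \sum_i (w 0 i + dotv (q s) (J *m q s))^-1 * (u s i 0 * v s i 0))) => [s|].
    by rewrite CmxE// [LHS]dotv_diag_mx; apply: eq_bigr => i _; rewrite mxE.
  apply: (@continuous_dotv_diag R n (fun s i => (w 0 i + dotv (q s) (J *m q s))^-1)
    (fun s i => u s i 0) (fun s i => v s i 0)) => // i.
  apply: cvgV; last by apply: cvgD => //; exact: cvg_cst.
  by rewrite gt_eqF// ltr_wpDr// dotv_diag_ge0.
have qCq : dotv (q t) (Cmx J (q t) *m q t) != 0.
  by rewrite gt_eqF// dotv_Cmx_gt0.
split; [exact: sc| |].
  by apply: cvgM; [exact: Cc|apply: cvgV => //; exact: Cc].
rewrite /hamiltonian; apply: cvgM; first exact: cvg_cst.
apply: cvgB; first exact: Cc.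
apply: cvgM; last by apply: cvgV => //; exact: Cc.
exact: cvgM (Cc p q pc qc) (Cc p q pc qc).
Qed.

(** Since B intertwines J with a diagonal matrix, each coordinate pair
((Bq)_i, (Bp)_i) satisfies its own linear system x' = c (y - a x), y' = - 2 H x,
with c = 1/(d_i + q . Jq) and a = (p . Cq)/(q . Cq). *)
Lemma reduced_solution_invariant n k (w : 'rV[R]_n) (d : 'rV[R]_k)
    (B : 'M[R]_(k, n)) (T : set R) (q p : R -> 'cV[R]_n) :
  (forall i, 0 < w 0 i) -> (forall i, 0 < d 0 i) ->
  B *m B^T = 1%:M -> B *m diag_mx w = diag_mx d *m B ->
  is_interval T -> T 0 -> reduced_solution (diag_mx w) T q p ->
  B *m q 0 = 0 -> B *m p 0 = 0 ->
  forall t, T t -> B *m q t = 0 /\ B *m p t = 0.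
Proof.
move=> w0 d0 BB BJ Titv T0 sol Bq0 Bp0 t Tt.
set J := diag_mx w in BJ sol.
pose sigma s := dotv (q s) (J *m q s).
pose a s := dotv (p s) (Cmx J (q s) *m q s) / dotv (q s) (Cmx J (q s) *m q s).
suff H i : (B *m q t) i 0 = 0 /\ (B *m p t) i 0 = 0.
  by split; apply/colP => i; rewrite [RHS]mxE; case: (H i).
apply: (@linear_ode_zero R T (fun s => (B *m q s) i 0)
  (fun s => (B *m p s) i 0) (fun s => - ((d 0 i + sigma s)^-1 * a s))
  (fun s => (d 0 i + sigma s)^-1) (fun s => - (2 * hamiltonian J (q s) (p s))));
  rewrite ?Bq0 ?Bp0 ?[LHS]mxE//.
- move=> s Ts; have [_ dq _] := sol s Ts.
  have /is_derive_mxP /(_ i 0) := is_derive_mulmxl_cst B dq.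
  rewrite /Cmx mulmxA; have s0 : 0 <= sigma s by exact: dotv_diag_ge0.
  rewrite (mass_intertwine BB BJ (diag_shift_inv w0 s0).1).2.
  rewrite (diag_shift_inv d0 s0).2 -mulmxA mulmxBr -scalemxAr mul_diag_mx.
  move=> dx; apply: is_derive_eq dx _; rewrite !mxE -/(a s).
  by rewrite -/(sigma s); ring.
- move=> s Ts; have [_ _ dp] := sol s Ts.
  have /is_derive_mxP /(_ i 0) := is_derive_mulmxl_cst B dp.
  by rewrite -scalemxAr mxE.
- move=> s Ts; have [[q1 _] dq dp] := sol s Ts.
  have [||sc ac Hc] := @reduced_coefs_continuous n w q p s w0 q1.
  - by move=> j; exact: is_derive_entry_continuous dq.
  - by move=> j; exact: is_derive_entry_continuous dp.
  have cc : {for s, continuous (fun s => (d 0 i + sigma s)^-1)}.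
    apply: cvgV; last by apply: cvgD => //; exact: cvg_cst.
    by rewrite gt_eqF// ltr_wpDr// dotv_diag_ge0.
  split; [|exact: cc|].
    by apply: cvgN; apply: cvgM; [exact: cc|exact: ac].
  by apply: cvgN; apply: cvgM; [exact: cvg_cst|exact: Hc].
Qed.
End Reduction.

(** * Restriction of the top to an invariant block *)

Section BlockReduction.
Context {R : realType}.

(** Bq = 0 gives B Om = - (Bv) q^T, and then
B I(Om) q = - (D + (q . Jq) Id) B v. So Bv vanishes as soon as B I(Om) q does,
that is, as soon as Bp = 0. *)
Lemma angular_velocity_invariant n k (J : 'M[R]_n) (D : 'M[R]_k)
    (B : 'M[R]_(k, n)) (q v : 'cV[R]_n) :
  let Om := vwedge q v in
  dotv q q = 1 -> B *m J = D *m B -> D + (dotv q (J *m q))%:M \in unitmx ->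
  B *m q = 0 -> B *m (inertia J Om *m q) = 0 -> B *m Om = 0.
Proof.
move=> Om q1 BJ U Bq BIq.
have BOm : B *m Om = - (B *m v *m q^T).
  by rewrite /Om /vwedge mulmxBr !mulmxA Bq mul0mx sub0r.
have BIE : B *m (inertia J Om *m q) = - ((D + (dotv q (J *m q))%:M) *m (B *m v)).
  rewrite /inertia mulmxDl mulmxDr -(mulmxA J) (mulmxA B J) BJ -(mulmxA D).
  rewrite (mulmxA B Om) -(mulmxA Om J) (mulmxA B Om) BOm !mulNmx -!mulmxA.
  rewrite !trmx_mul_dotv q1 mulmx1 mul_mx_scalar mulmxDl mul_scalar_mx.
  by rewrite mulmxN -scalemxAr opprD.
suff Bv : B *m v = 0 by rewrite BOm Bv mul0mx oppr0.
move/eqP: BIq; rewrite BIE oppr_eq0 => /eqP DBv.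
by rewrite -[LHS](mulKmx U) DBv mulmx0.
Qed.

Lemma evec0_col_mx m k : (0 < m)%N ->
  evec (m + k) 0 = col_mx (evec m 0) 0 :> 'cV[R]_(m + k).
Proof.
move=> m0; apply/colP => i; rewrite mxE -(fintype.splitK i).
case: (fintype.split i) => j /=; rewrite ?col_mxEu ?col_mxEd !mxE//=.
by rewrite addn_eq0 eqn0Ngt m0.
Qed.

(** Prescribing the matrix of g0 in the new bases as block_mx h 0 0 1 determines
Ps = block_mx h 0 0 1 Pb g0^T; the distinguished axis is preserved precisely when
h sends the W-coordinates of q to e_1, and a reflection does that. *)
Lemma adapted_space_basis m k n (Pb : 'M[R]_(m + k, n)) (g0 : 'M[R]_n) :
  (0 < m)%N -> (0 < n)%N -> is_orthomx Pb -> is_orthomx g0 ->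
  dsubmx (Pb *m body_axis g0 0) = 0 ->
  exists Ps : 'M[R]_(m + k, n),
    [/\ is_orthomx Ps, Ps *m evec n 0 = evec (m + k) 0 &
        Ps *m g0 *m (dsubmx Pb)^T = col_mx 0 1%:M].
Proof.
move=> m0 n0 Pbo go Bq; pose qb := usubmx (Pb *m body_axis g0 0).
have qE : body_axis g0 0 = g0^T *m evec n 0 by rewrite /body_axis invmx_orthomx.
have PqE : Pb *m body_axis g0 0 = col_mx qb 0 by rewrite -Bq vsubmxK.
have dotv_e0 l : (0 < l)%N -> dotv (evec l 0) (evec l 0) = 1 :> R.
  by case: l => // l _; rewrite -[0%N]/(nat_of_ord (@ord0 l)) dotv_evec mxE eqxx.
have qb1 : dotv qb qb = dotv (evec m 0) (evec m 0).
  rewrite dotv_e0// -(dotv_e0 n n0).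
  have -> : dotv qb qb = dotv (col_mx qb 0 : 'cV_(m + k)) (col_mx qb 0).
    by rewrite /dotv tr_col_mx mul_row_col mulmx0 addr0.
  rewrite -PqE qE mulmxA dotv_mulmx mulmxA trmx_mul trmxK.
  by rewrite -(mulmxA g0) (mulmxA Pb^T) Pbo.1 mul1mx go.2 mul1mx.
have [h [ho hq _]] := reflection_exists qb1.
exists (block_mx h 0 0 1%:M *m Pb *m g0^T); split.
- apply: orthomx_mul; last exact: orthomx_tr.
  by apply: orthomx_mul => //; apply: orthomx_block => //; split; rewrite trmx1 mul1mx.
- rewrite -!mulmxA -qE PqE mul_block_col !mul0mx !mulmx0 !addr0 hq.
  by rewrite evec0_col_mx.
- rewrite -!mulmxA (mulmxA g0^T) go.1 mul1mx.
  have -> : Pb *m (dsubmx Pb)^T = col_mx 0 1%:M.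
    have [_] := Pbo; rewrite -{2}(vsubmxK Pb) tr_col_mx mul_mx_row.
    by rewrite scalar_mx_block block_mxEh => /eq_row_mx[].
  by rewrite mul_block_col !mul0mx !mulmx0 !addr0 mul1mx add0r.
Qed.

(** Holds for any diagonal mass tensor and any orthonormal body basis that splits
it into blocks, provided q and p start in the span of the first m basis vectors
and the last k body axes start as the last k space axes. *)
Lemma block_reduction n m k (w : 'rV[R]_n) (Jb : 'M[R]_m) (d : 'rV[R]_k)
    (Pb Ps : 'M[R]_(m + k, n)) (T : set R)
    (q p : R -> 'cV[R]_n) (g Om : R -> 'M[R]_n) :
  let J := diag_mx w in
  (0 < m)%N -> is_interval T -> T 0 ->
  (forall i, 0 < w 0 i) -> (forall i, 0 < d 0 i) ->
  is_orthomx Pb -> is_orthomx Ps ->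
  Ps *m evec n 0 = evec (m + k) 0 ->
  Pb *m J *m Pb^T = block_mx Jb 0 0 (diag_mx d) ->
  reduced_solution J T q p -> top_solution J T g Om ->
  (forall t, T t -> reduction J (g t) (Om t) = (q t, p t)) ->
  dsubmx (Pb *m q 0) = 0 -> dsubmx (Pb *m p 0) = 0 ->
  Ps *m g 0 *m (dsubmx Pb)^T = col_mx 0 1%:M ->
  exists (qb pb : R -> 'cV[R]_m) (gb Omb : R -> 'M[R]_m),
    [/\ forall t, T t ->
          [/\ Pb *m q t = col_mx (qb t) 0,
              Pb *m p t = col_mx (pb t) 0,
              Ps *m g t *m Pb^T = block_mx (gb t) 0 0 1%:M &
              Pb *m Om t *m Pb^T = block_mx (Omb t) 0 0 0],
        top_solution Jb T gb Omb & reduced_solution Jb T qb pb].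
Proof.
move=> J m0 Titv T0 w0 d0 Pbo Pso Ps0 PJP redsol topsol redq Bq0 Bp0 Gr0.
pose A := usubmx Pb; pose B := dsubmx Pb.
have PbE : Pb = col_mx A B by rewrite vsubmxK.
have [AABB [AA AB BA BB]] : A^T *m A + B^T *m B = 1%:M /\
    [/\ A *m A^T = 1%:M, A *m B^T = 0, B *m A^T = 0 & B *m B^T = 1%:M].
  have [] := Pbo; rewrite PbE tr_col_mx mul_row_col mul_col_row => -> /esym.
  by rewrite scalar_mx_block => /eq_block_mx[-> -> -> ->].
have [AJ BJ] : A *m J = Jb *m A /\ B *m J = diag_mx d *m B.
  have : Pb *m J = block_mx Jb 0 0 (diag_mx d) *m Pb.
    by rewrite -PJP -mulmxA Pbo.1 mulmx1.
  rewrite PbE mul_col_mx mul_block_col !mul0mx addr0 add0r.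
  by move=> /eq_col_mx.
have JT : J^T = J by rewrite tr_diag_mx.
have JbT : Jb^T = Jb.
  have -> : Jb = A *m J *m A^T by rewrite AJ -mulmxA AA mulmx1.
  by rewrite !trmx_mul trmxK JT mulmxA.
have JA : A^T *m Jb = J *m A^T.
  by apply: trmx_inj; rewrite !trmx_mul !trmxK JT JbT AJ.
have BqBp : forall t, T t -> B *m q t = 0 /\ B *m p t = 0.
  by apply: (reduced_solution_invariant w0 d0 BB BJ Titv T0 redsol);
    rewrite mul_dsub_mx.
have AtA l (u : 'M[R]_(n, l)) : B *m u = 0 -> A^T *m (A *m u) = u.
  by move=> Bu; rewrite -[RHS]mul1mx -AABB mulmxDl -!mulmxA Bu mulmx0 addr0.
have dotA u v : B *m u = 0 -> dotv (A *m u) (A *m v) = dotv u v.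
  by move=> Bu; rewrite dotvC dotv_mulmx AtA// dotvC.
have sig0 u : 0 <= dotv u (J *m u) by exact: dotv_diag_ge0.
have full t : T t -> [/\ is_orthomx (g t), body_axis (g t) 0 = q t,
    B *m q t = 0, B *m Om t = 0 /\ Om t *m B^T = 0 &
    exists v, Om t = vwedge (q t) v].
  move=> Tt; have [[go [v OmE]] _ _] := topsol t Tt.
  have [Bq Bp] := BqBp t Tt; have [[q1 _] _ _] := redsol t Tt.
  have [qE pE] := redq t Tt; rewrite qE in OmE pE.
  have BOm : B *m Om t = 0.
    rewrite OmE; apply: (angular_velocity_invariant q1 BJ _ Bq).
      by have [] := diag_shift_inv d0 (sig0 (q t)).
    by rewrite -OmE -[_ *m q t]opprK pE mulmxN Bp oppr0.
  split => //; last by exists v.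
  split => //.
  apply: trmx_inj; rewrite trmx_mul trmxK trmx0 OmE vwedge_skew -OmE.
  by rewrite mulmxN BOm oppr0.
(* g' = g Om and Om B^T = 0, so g B^T is constant. *)
have gB t : T t -> Ps *m g t *m B^T = col_mx 0 1%:M.
  move=> Tt; rewrite -Gr0.
  apply: (@interval_const R _ _ (fun s => Ps *m g s *m B^T) T) => // s Ts.
  have [_ _ _ [_ OmB] _] := full s Ts; have [_ dg _] := topsol s Ts.
  have := is_derive_mulmx_cst Ps B^T dg.
  by rewrite mulmxA -mulmxA OmB mulmx0.
pose gb t := usubmx Ps *m g t *m A^T.
have GE t : T t -> Ps *m g t *m Pb^T = block_mx (gb t) 0 0 1%:M.
  move=> Tt; have [go _ _ _ _] := full t Tt.
  have Go : is_orthomx (Ps *m g t *m Pb^T).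
    by apply: orthomx_mul; [exact: orthomx_mul|exact: orthomx_tr].
  have E : Ps *m g t *m Pb^T
      = block_mx (gb t) 0 (dsubmx Ps *m g t *m A^T) 1%:M.
    rewrite {1}PbE tr_col_mx mul_mx_row gB//.
    by rewrite block_mxEh /gb -!mul_col_mx vsubmxK.
  (* The right blocks come from gB; orthogonality then kills the lower left one. *)
  rewrite E; congr block_mx.
  have [+ _] := Go; rewrite E tr_block_mx mulmx_block trmx0 trmx1.
  rewrite scalar_mx_block => /eq_block_mx[_ _ + _].
  by rewrite mul0mx add0r mul1mx.
have gbo t : T t -> is_orthomx (gb t).
  move=> Tt; have [go _ _ _ _] := full t Tt.
  have : is_orthomx (Ps *m g t *m Pb^T).
    by apply: orthomx_mul; [exact: orthomx_mul|exact: orthomx_tr].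
  rewrite GE// /is_orthomx tr_block_mx !mulmx_block !trmx0 !mulmx0 !mul0mx.
  rewrite !addr0 scalar_mx_block.
  by move=> [/eq_block_mx[? _ _ _] /eq_block_mx[? _ _ _]].
have gbq t : T t -> body_axis (gb t) 0 = A *m q t.
  move=> Tt; have [go qE _ _ _] := full t Tt.
  rewrite /body_axis invmx_orthomx; last exact: gbo.
  have : (Ps *m g t *m Pb^T)^T *m evec (m + k) 0 = Pb *m q t.
    rewrite -Ps0 !trmx_mul trmxK -!mulmxA (mulmxA Ps^T) Pso.1 mul1mx -qE.
    by rewrite /body_axis invmx_orthomx.
  rewrite GE// PbE evec0_col_mx// tr_block_mx mul_block_col !trmx0.
  rewrite !mul0mx !mulmx0 addr0.
  by rewrite mul_col_mx => /eq_col_mx[->].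
exists (fun t => A *m q t), (fun t => A *m p t), gb, (fun t => A *m Om t *m A^T).
split.
- move=> t Tt; have [_ _ Bq [BOm OmB] _] := full t Tt; have [_ Bp] := BqBp t Tt.
  split => //; [by rewrite PbE mul_col_mx Bq|by rewrite PbE mul_col_mx Bp|exact: GE|].
  rewrite PbE tr_col_mx mul_col_mx mul_col_row BOm !mul0mx.
  by rewrite -[A *m Om t *m B^T]mulmxA OmB mulmx0.
- move=> t Tt; have [go qE Bq [BOm OmB] [v OmE]] := full t Tt.
  have [_ dg [lambda dI]] := topsol t Tt.
  have AtAOm l (Y : 'M[R]_(n, l)) : A^T *m (A *m (Om t *m Y)) = Om t *m Y.
    by rewrite AtA// mulmxA BOm mul0mx.
  have OmAtA l (Y : 'M[R]_(n, l)) : Om t *m (A^T *m (A *m Y)) = Om t *m Y.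
    have OmE' : Om t *m A^T *m A = Om t.
      by rewrite -[RHS]mulmx1 -AABB mulmxDr !mulmxA OmB mul0mx addr0.
    by rewrite !mulmxA OmE'.
  have inE s : inertia Jb (A *m Om s *m A^T) = A *m inertia J (Om s) *m A^T.
    rewrite /inertia mulmxDr mulmxDl !mulmxA -AJ; congr (_ + _).
    by rewrite -!mulmxA JA.
  split.
  + split; first exact: gbo.
    by exists (A *m v); rewrite OmE mulmx_vwedge gbq.
  + have := is_derive_mulmx_cst (usubmx Ps) A^T dg; rewrite /gb.
    by rewrite -!mulmxA AtAOm.
  + (* The multipliers for the block differ from lambda, because Ps moves the
       axes other than e_1; they exist by the characterization of torques. *)
    set X := \sum_(1 <= i < n) _ in dI.
    have [Xskew Xq] : X^T = - X /\ X *m body_axis (g t) 0 = 0.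
      by apply/(reactionP _ go); exists lambda.
    have /(reactionP _ (gbo t Tt)) [lambda' lE] :
        (A *m X *m A^T)^T = - (A *m X *m A^T) /\
        (A *m X *m A^T) *m body_axis (gb t) 0 = 0.
      split; first by rewrite !trmx_mul trmxK Xskew mulNmx mulmxN mulmxA.
      by rewrite gbq// -!mulmxA AtA// -qE Xq mulmx0.
    exists lambda'; rewrite -lE.
    under eq_fun do rewrite inE.
    have := is_derive_mulmx_cst A A^T dI.
    suff -> : A *m (lie_bracket (inertia J (Om t)) (Om t) + X) *m A^T
      = lie_bracket (inertia Jb (A *m Om t *m A^T)) (A *m Om t *m A^T)
        + A *m X *m A^T by [].
    rewrite mulmxDr mulmxDl; congr (_ + _).
    rewrite inE /lie_bracket mulmxBr mulmxBl; congr (_ - _).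
      by rewrite -!mulmxA AtAOm.
    by rewrite -!mulmxA OmAtA.
- move=> t Tt; have [Bq Bp] := BqBp t Tt; have [[q1 qp] dq dp] := redsol t Tt.
  have CA u : A *m (Cmx J (q t) *m u) = Cmx Jb (A *m q t) *m (A *m u).
    rewrite /Cmx (mulmxA Jb) -AJ -mulmxA dotA//.
    by rewrite mulmxA (mass_intertwine AA AJ (diag_shift_inv w0 (sig0 _)).1).2 mulmxA.
  have CJ u v : B *m u = 0 ->
      dotv (A *m u) (Cmx Jb (A *m q t) *m (A *m v)) = dotv u (Cmx J (q t) *m v).
    by move=> Bu; rewrite -CA dotA.
  split.
  + by split; rewrite dotA.
  + have := is_derive_mulmxl_cst A dq.
    by rewrite CA mulmxBr -scalemxAr !CJ.
  + have := is_derive_mulmxl_cst A dp.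
    by rewrite -scalemxAr /hamiltonian !CJ.
Qed.
End BlockReduction.

(** * The cylindrical top *)

Theorem theorem5p7 (R : realType) (r r' : nat) (J1 J2 : R)
    (n_gt4 : (4 < r + r')%N) (r_ge2 : (2 <= r)%N) (le_rr' : (r <= r')%N)
    (J1_gt0 : 0 < J1) (J2_gt0 : 0 < J2) (J1_neq_J2 : J1 != J2)
    (T : set R) (T_open : open T) (T_itv : is_interval T) (T0 : T 0)
    (c : R -> set ('cV[R]_(r + r') * 'cV[R]_(r + r')))
    (c_sol : quotient_solution J1 J2 T c)
    (g0 Om0 : 'M[R]_(r + r')) (q0 p0 : 'cV[R]_(r + r'))
    (lift0_D : Dspace g0 Om0)
    (lift0_qp : reduction (cyl_mass r r' J1 J2) g0 Om0 = (q0, p0))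
    (lift0_c : GR_orbit (q0, p0) = c 0) :
  exists Pb Ps : 'M[R]_(4 + (r + r' - 4), r + r'),
    [/\ is_orthomx Pb, is_orthomx Ps,
        Ps *m evec (r + r') 0 = evec (4 + (r + r' - 4)) 0 &
        exists d : 'rV[R]_(r + r' - 4),
          Pb *m cyl_mass r r' J1 J2 *m Pb^T
          = block_mx (cyl_mass 2 2 J1 J2 : 'M[R]_4) 0 0 (diag_mx d)]
    /\
    forall (q p : R -> 'cV[R]_(r + r')) (g Om : R -> 'M[R]_(r + r')),
      lifted_solution J1 J2 T c q p g Om ->
      q 0 = q0 -> p 0 = p0 -> g 0 = g0 -> Om 0 = Om0 ->
      exists (qb pb : R -> 'cV[R]_4) (gb Omb : R -> 'M[R]_4),
        [/\ forall t, T t ->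
              [/\ Pb *m q t = col_mx (qb t) 0,
                  Pb *m p t = col_mx (pb t) 0,
                  Ps *m g t *m Pb^T = block_mx (gb t) 0 0 1%:M &
                  Pb *m Om t *m Pb^T = block_mx (Omb t) 0 0 0],
            top_solution (cyl_mass 2 2 J1 J2 : 'M[R]_4) T gb Omb &
            reduced_solution (cyl_mass 2 2 J1 J2 : 'M[R]_4) T qb pb].
Proof.
have r'_ge2 : (2 <= r')%N := leq_trans r_ge2 le_rr'.
have [g0o _] := lift0_D; move: (lift0_qp) => [q0E _].
have [Pb [d [Pbo d0 PJP Bq Bp]]] := adapted_body_basis q0 p0 r_ge2 r'_ge2 J1_gt0 J2_gt0.
have n0 : (0 < r + r')%N by exact: leq_trans n_gt4.
have [|Ps [Pso Pse Psg]] := adapted_space_basis (isT : 0 < 4)%N n0 Pbo g0o.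
  by rewrite q0E.
exists Pb, Ps; split; first by split => //; exists d.
move=> q p g Om [redsol _ topsol redq] qz pz gz _.
apply: (block_reduction (isT : 0 < 4)%N T_itv T0 _ d0 Pbo Pso Pse PJP
          redsol topsol redq).
- by move=> i; exact: cyl_weight_gt0.
- by rewrite qz.
- by rewrite pz.
- by rewrite gz.
Qed.
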